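(* Consider the linear regression model $X_k=\theta\phi_k+\varepsilon_k$, $k=1,\dots,n$, where $\theta\in\mathbb{R}$ is an unknown parameter, $(\phi_k)_{k=1,\dots,n}$ is a sequence of independent random variables, $(\varepsilon_k)_{k=1,\dots,n}$ is a sequence of martingale differences with respect to its natural filtration, and $(\phi_k)$ and $(\varepsilon_k)$ are independent. Let $\theta_n=\sum_{k=1}^n\phi_kX_k\big/\sum_{k=1}^n\phi_k^2$. Assume that for constants $\alpha\in(0,1)$, $E$ and $F$, $$\mathbf{E}\big[\varepsilon_i^2\,\big|\,\sigma\{\varepsilon_j,j\le i-1\}\big]\le E\quad\text{and}\quad\mathbf{E}\big[\exp\{|\varepsilon_i|^{\alpha/(1-\alpha)}\}\big]\le F$$ for all $i\in[1,n]$. Then for all $x>0$, for each choice of sign $\pm$, $$\mathbf{P}\Big(\pm(\theta_n-\theta)\sqrt{\textstyle\sum_{k=1}^n\phi_k^2}\ge x\Big)\le\exp\Big\{-\frac{x^2}{2(E+\frac13x^{2-\alpha})}\Big\}+nF\exp\{-x^\alpha\}.$$ In particular, for any $x>0$ there is $c_x>0$ not depending on $n$ such that $$\mathbf{P}\Big(\pm(\theta_n-\theta)\sqrt{\textstyle\sum_{k=1}^n\phi_k^2}\ge\sqrt n\,x\Big)=O\big(\exp\{-c_xn^{\alpha/2}\}\big),\quad n\to\infty.$$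
   Context: It is implicitly assumed that $\sum_{k=1}^n\phi_k^2>0$ almost surely, so that $\theta_n$ is well defined. *)

(* Defs.v *)
From HB Require Import structures.
From mathcomp Require Import all_boot all_order all_algebra.
From mathcomp Require Import all_classical all_reals all_analysis.
Set Implicit Arguments. Unset Strict Implicit. Unset Printing Implicit Defensive.
Import Order.TTheory GRing.Theory Num.Theory.
Local Open Scope classical_set_scope.
Local Open Scope ring_scope.

Section Defs.
Context (d : measure_display) (T : measurableType d) (R : realType).

Definition gen_sigma (J : set nat) (f : nat -> T -> R) : set (set T) :=
  <<s [set A | exists j B, J j /\ measurable B /\ A = f j @^-1` B] >>.

Definition is_cond_exp (P : probability T R) (G : set (set T)) (X g : T -> R) :=
  [/\ forall B : set R, measurable B -> G (g @^-1` B),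
      P.-integrable setT (EFin \o g) &
      forall A, G A -> (\int[P]_(w in A) (g w)%:E = \int[P]_(w in A) (X w)%:E)%E].

Definition mutually_indep (P : probability T R) (n : nat) (G : nat -> set (set T)) :=
  forall A : nat -> set T, (forall k, (1 <= k <= n)%N -> G k (A k)) ->
    P (\big[setI/setT]_(1 <= k < n.+1) A k) = (\prod_(1 <= k < n.+1) fine (P (A k)))%:E.

Definition indep2 (P : probability T R) (G1 G2 : set (set T)) :=
  forall A B, G1 A -> G2 B -> P (A `&` B) = (fine (P A) * fine (P B))%:E.

Definition regX (theta : R) (phi eps : nat -> T -> R) (k : nat) (w : T) : R :=
  theta * phi k w + eps k w.

Definition sumsq (n : nat) (phi : nat -> T -> R) (w : T) : R :=
  \sum_(1 <= k < n.+1) phi k w ^+ 2.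

Definition thetan (n : nat) (theta : R) (phi eps : nat -> T -> R) (w : T) : R :=
  (\sum_(1 <= k < n.+1) phi k w * regX theta phi eps k w) / sumsq n phi w.

Definition regression_hyp (P : probability T R) (n : nat) (phi eps : nat -> T -> R)
    (alpha E F : R) :=
  (forall k, (1 <= k <= n)%N -> measurable_fun setT (phi k)) /\
  (forall k, (1 <= k <= n)%N -> measurable_fun setT (eps k)) /\
  mutually_indep P n (fun k => gen_sigma [set k] phi) /\
  indep2 P (gen_sigma [set k | (1 <= k <= n)%N] phi)
           (gen_sigma [set k | (1 <= k <= n)%N] eps) /\
  (forall i, (1 <= i <= n)%N ->
     P.-integrable setT (EFin \o eps i) /\
     is_cond_exp P (gen_sigma [set j | (1 <= j <= i.-1)%N] eps) (eps i) (fun _ => 0)) /\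
  (forall i, (1 <= i <= n)%N -> exists g : T -> R,
     is_cond_exp P (gen_sigma [set j | (1 <= j <= i.-1)%N] eps)
                 (fun w => eps i w ^+ 2) g /\ {ae P, forall w, g w <= E}) /\
  (forall i, (1 <= i <= n)%N ->
     (\int[P]_w (expR (`|eps i w| `^ (alpha / (1 - alpha))))%:E <= F%:E)%E) /\
  (* standing assumption: sum phi_k^2 > 0 almost surely *)
  {ae P, forall w, 0 < sumsq n phi w}.

End Defs.

(* Main.v *)
Require Import Defs.
From HB Require Import structures.
From mathcomp Require Import all_boot all_order all_algebra.
From mathcomp Require Import all_classical all_reals all_analysis.
From mathcomp Require Import measurable_realfun ring lra.
Set Implicit Arguments. Unset Strict Implicit. Unset Printing Implicit Defensive.
Import Order.TTheory GRing.Theory Num.Theory.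
Import numFieldNormedType.Exports.
Local Open Scope classical_set_scope.
Local Open Scope ring_scope.

(** With [a_k = +- phi_k / sqrt (sum_j phi_j ^ 2)], the self-normalized error is exactly
    [sum_k a_k * eps_k], where [sum_k a_k ^ 2 <= 1]. Since the [phi_k] are independent of
    the [eps_k], the [eps_k] keep their conditional means and variances when the whole
    family [phi] is added to the past. Truncating [a_k * eps_k] at [y] and applying
    Bernstein's inequality [expR u <= 1 + u + u ^ 2 / (2 * (1 - v / 3))] for [u <= v < 3]
    makes [expR (sum_(j <= k) (lam * trunc y (a_j * eps_j) - D * E * a_j ^ 2))] a
    supermartingale, where [D = lam ^ 2 / (2 * (1 - lam * y / 3))]. Markov's inequality
    controls the truncated sum; since [|a_k| <= 1], the truncation matters only when some
    [|eps_k| > y], which the exponential moment controls. The stated bound is the case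
    [y = x `^ (1 - alpha)], [lam = x / (E + x * y / 3)]. *)

(** * Elementary inequalities for the exponential *)

Lemma is_derive_ge0_le {R : realType} (f f' : R -> R) (a b : R) :
  (forall x, is_derive x (1 : R) f (f' x)) -> (forall x, a < x < b -> 0 <= f' x) ->
  a <= b -> f a <= f b.
Proof.
move=> df f'0 ab; apply: (@ger0_derive1_ndecr _ f a b) => //.
- by move=> z; rewrite in_itv/= => zab; rewrite derive1E derive_val f'0.
- apply: continuous_subspaceT => z.
  exact/differentiable_continuous/derivable1_diffP.
Qed.

(* The difference of the two sides vanishes at 0 together with its first
   derivative, and its second derivative [(1 - expR u * (1 - u)) / 3] is nonnegative. *)
Lemma expR_mul_le {R : realType} (u : R) :
  expR u * (1 - u / 3) <= 1 + 2 * u / 3 + u ^+ 2 / 6.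
Proof.
pose f (u : R) := 1 + 2 * u / 3 + u ^+ 2 / 6 - expR u * (1 - u / 3).
pose g (u : R) := 2 / 3 + u / 3 - expR u * (2 / 3 - u / 3).
have dg (x : R) : is_derive x (1 : R) g ((1 - expR x * (1 - x)) / 3).
  apply: is_derive_eq.
  by rewrite /GRing.scale /=; field.
have df (x : R) : is_derive x (1 : R) f (g x).
  apply: is_derive_eq.
  by rewrite /GRing.scale /= /g; field.
have g_homo (x y : R) : x <= y -> g x <= g y.
  apply: is_derive_ge0_le => // z _.
  have := expR_ge1Dx (- z); rewrite expRN => h.
  have e0 := expR_gt0 z.
  rewrite divr_ge0// subr_ge0.
  by rewrite mulrC -ler_pdivlMr// div1r.
have g0 : g 0 = 0 by rewrite /g expR0; field.
have f0 : f 0 = 0 by rewrite /f expR0; field.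
suff: 0 <= f u by rewrite /f subr_ge0.
case: (leP 0 u) => u0.
  rewrite -f0; apply: is_derive_ge0_le u0 => // x /andP[x0 _].
  by rewrite -g0 g_homo// ltW.
(* For negative [u] the same argument runs on the reflected function, whose derivative [- g (- x)]
   is nonnegative for positive [x]. *)
have dNf (x : R) : is_derive x (1 : R) (f \o -%R) (- g (- x)).
  by apply: is_derive_eq; rewrite /GRing.scale /=; ring.
have := @is_derive_ge0_le _ _ _ 0 (- u) dNf; rewrite /= oppr0 opprK f0; apply.
- by move=> x /andP[x0 _]; rewrite oppr_ge0 -g0 g_homo// oppr_le0 ltW.
- by rewrite oppr_ge0 ltW.
Qed.

(** Multiplied by [1 - u / 3 > 0], the case [v = u] is exactly [expR_mul_le]; the right-hand side
    grows with [v], its denominator shrinking while staying positive. *)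
Lemma expR_le_bernstein {R : realType} (u v : R) : u <= v -> v < 3 ->
  expR u <= 1 + u + u ^+ 2 / (2 * (1 - v / 3)).
Proof.
move=> uv v3.
have hv : 0 < 1 - v / 3 by lra.
have hu : 0 < 1 - u / 3 by lra.
have e0 := expR_mul_le u.
apply: (@le_trans _ _ (1 + u + u ^+ 2 / (2 * (1 - u / 3)))).
  rewrite -(ler_pM2r hu); apply: le_trans e0 _.
  rewrite le_eqVlt; apply/orP; left; apply/eqP; field.
  by rewrite lt0r_neq0//; lra.
rewrite lerD2l ler_wpM2l ?sqr_ge0// lef_pV2 ?posrE ?mulr_gt0//.
by rewrite ler_pM2l//; lra.
Qed.

(** * Vanishing conditional means as orthogonality relations *)

Section orthogonality.
Context (d : measure_display) (T : measurableType d) (R : realType).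
Variable P : probability T R.

(** Dynkin's pi-lambda argument: the measurable sets over which [Y] integrates to 0 are stable under
    complement, the whole space being one of them, and under countable disjoint unions. *)
Lemma integral_eq0_sigma (G : set (set T)) (Y : T -> R) :
  setI_closed G -> G `<=` measurable -> G setT ->
  P.-integrable setT (EFin \o Y) ->
  (forall A, G A -> (\int[P]_(w in A) (Y w)%:E = 0)%E) ->
  forall A, <<s G >> A -> (\int[P]_(w in A) (Y w)%:E = 0)%E.
Proof.
move=> GI Gm GT iY GY.
have sGm : <<s G >> `<=` measurable.
  by apply: smallest_sub => //; exact: sigma_algebra_measurable.
rewrite -(setI_closed_g_dynkin_g_sigma_algebra GI) in sGm *.
pose H := [set A | measurable A /\ (\int[P]_(w in A) (Y w)%:E = 0)%E].
suff: <<d G >> `<=` H by move=> h A /h[].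
have iYA A : measurable A -> P.-integrable A (EFin \o Y).
  by move=> mA; exact: integrableS iY.
apply: smallest_sub; last by move=> A GA; split; [exact: Gm|exact: GY].
split.
- by split => //; exact: GY.
- move=> A [mA A0]; split; first exact: measurableC.
  have := GY _ GT; rewrite -(setUv A) integral_setU_EFin//.
  + by rewrite A0 add0e.
  + exact: measurableC.
  + by rewrite setUv; apply/measurable_EFinP/(measurable_int P).
  + exact/disj_setPCl.
- move=> F tF HF; split; first by apply: bigcup_measurable => k _; case: (HF k).
  rewrite (integral_bigcup tF).
  + by apply: eseries0 => k _ _; case: (HF k).
  + by move=> k; case: (HF k).
  + by apply: iYA; apply: bigcup_measurable => k _; case: (HF k).
Qed.

Import HBNNSimple.

Lemma measurable_fun_g_sigma (G : set (set T)) (f : T -> R) :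
  <<s G >> `<=` measurable ->
  measurable_fun [set: g_sigma_algebraType G] (f : g_sigma_algebraType G -> R) ->
  measurable_fun setT f.
Proof.
move=> Gm mf _ B mB; rewrite setTI; apply: Gm; rewrite -[_ @^-1` _]setTI.
exact: mf.
Qed.

Lemma integral_indicMl (A : set T) (Y : T -> R) :
  (\int[P]_(w in A) (Y w)%:E = \int[P]_w (\1_A w * Y w)%:E)%E.
Proof.
rewrite integral_mkcond; apply: eq_integral => w _; rewrite patchE indicE.
by case: (w \in A); rewrite ?mul1r ?mul0r.
Qed.

Lemma integrable_indicMl (A : set T) (Y : T -> R) : measurable A ->
  P.-integrable setT (EFin \o Y) ->
  P.-integrable setT (fun w => (\1_A w * Y w)%:E).
Proof.
move=> mA iY.
have mY : measurable_fun setT Y by apply/measurable_EFinP/(measurable_int P).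
apply: le_integrable iY => //.
- by apply/measurable_EFinP/measurable_funM.
- move=> w _ /=; rewrite lee_fin normrM indicE.
  by rewrite normr_nat; case: (w \in A); rewrite ?mul1r ?mul0r ?normr_ge0.
Qed.

(** After splitting [h] into positive and negative parts, simple functions increasing to [h] extend
    the relation from events to [h]. Convergence is dominated by [|h * Y|], so [h] may be
    unbounded. *)
Lemma integral_mul_eq0 (G : set (set T)) (Y h : T -> R) :
  <<s G >> `<=` measurable ->
  P.-integrable setT (EFin \o Y) ->
  (forall A, <<s G >> A -> (\int[P]_(w in A) (Y w)%:E = 0)%E) ->
  measurable_fun [set: g_sigma_algebraType G] (h : g_sigma_algebraType G -> R) ->
  P.-integrable setT (fun w => (h w * Y w)%:E) ->
  (\int[P]_w (h w * Y w)%:E = 0)%E.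
Proof.
move=> Gm iY Y0.
have mY : measurable_fun setT Y by apply/measurable_EFinP/(measurable_int P).
wlog h0 : h / (forall w, 0 <= h w).
  move=> wl mh ihY.
  have mp := measurable_funrpos mh.
  have mn := measurable_funrneg mh.
  have bd (f : T -> R) :
      measurable_fun [set: g_sigma_algebraType G] (f : g_sigma_algebraType G -> R) ->
      (forall w, 0 <= f w <= `|h w|) -> P.-integrable setT (fun w => (f w * Y w)%:E).
    move=> mf fh; apply: le_integrable ihY => //.
    - by apply/measurable_EFinP/measurable_funM => //; exact: measurable_fun_g_sigma mf.
    - move=> w _ /=; rewrite lee_fin !normrM ler_wpM2r//.
      by have /andP[f0 ?] := fh w; rewrite ger0_norm.
  have ip := bd _ mp; have ineg := bd _ mn.
  have {}ip : P.-integrable setT (fun w => (h^\+ w * Y w)%:E).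
    by apply: ip => w; rewrite /funrpos le_max lexx orbT /= ge_max ler_norm normr_ge0.
  have {}ineg : P.-integrable setT (fun w => (h^\- w * Y w)%:E).
    apply: ineg => w.
    by rewrite /funrneg le_max lexx orbT /= ge_max -normrN ler_norm normr_ge0.
  under eq_integral => w _.
    rewrite [X in X * _](_ : _ = h^\+ w - h^\- w); last by rewrite -[in LHS](funrposBneg h).
    rewrite mulrBl EFinB; over.
  rewrite /= integralB_EFin// !wl ?sube0//.
move=> mh ihY.
(* Approximating on [T'] rather than on [T] keeps the level sets of the simple functions in
   [<<s G>>]. *)
pose T' := g_sigma_algebraType G.
have mh' : measurable_fun [set: T'] (EFin \o (h : T' -> R)) by exact/measurable_EFinP.
pose a n : T' -> R := nnsfun_approx measurableT mh' n.
have ma n : measurable_fun setT (a n : T -> R).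
  by apply: measurable_fun_g_sigma Gm _; exact: measurable_funPT.
have ah n w : 0 <= a n w <= h w.
  apply/andP; split; first exact: fun_ge0.
  rewrite /a nnsfun_approxE -lee_fin.
  by apply: (@le_approx _ _ _ setT (EFin \o h)) => // v _; rewrite lee_fin.
have cva w : (a ^~ w) @ \oo --> h w.
  have := @cvg_nnsfun_approx _ _ _ _ measurableT _ mh' (fun _ _ => h0 _) w I.
  by move/fine_cvgP => [_].
have aY0 n : (\int[P]_w (a n w * Y w)%:E = 0)%E.
  rewrite /a.
  set s := nnsfun_approx _ _ _.
  have ms r : <<s G >> (s @^-1` [set r]).
    by rewrite -[_ @^-1` _]setTI; apply: (@measurable_funPT _ _ _ _ s).
  have ir r : P.-integrable setT (fun w => (\1_(s @^-1` [set r]) w * Y w)%:E).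
    by apply: integrable_indicMl => //; apply: Gm; exact: ms.
  under eq_integral => w _ do rewrite fimfunEord mulr_suml -sumEFin.
  rewrite integral_sum//.
    rewrite big1// => i _; under eq_integral => w _ do rewrite -mulrA EFinM.
    by rewrite integralZl// -integral_indicMl Y0 ?mule0//; exact: ms.
  by move=> i; under eq_fun do rewrite -mulrA EFinM; exact: integrableZl.
have [|||||_ _] := @dominated_convergence _ T _ P setT measurableT
  (fun n w => (a n w * Y w)%:E) (fun w => (h w * Y w)%:E) (fun w => (`|h w * Y w|)%:E).
- by move=> n; apply/measurable_EFinP/measurable_funM.
- exact: (measurable_int P).
- apply: aeW => w _; apply: cvg_EFin; first exact: nearW.
  by apply: cvgMr_tmp; exact: cva.
- exact: (integrable_norm ihY).
- apply: aeW => w n _; rewrite lee_fin !normrM ler_wpM2r//.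
  by have /andP[? ?] := ah n w; rewrite !ger0_norm.
under [X in X @ _ --> _]eq_fun do rewrite aY0.
by move/(cvg_lim (@ereal_hausdorff _)); rewrite lim_cst// => <-.
Qed.

Lemma g_sigma_setI (G : set (set T)) : setI_closed <<s G >>.
Proof. by move=> A B; exact: (@measurableI _ (g_sigma_algebraType G)). Qed.

(** By independence the centred indicator [\1_A - p] integrates to 0 over every event of [<<s Ge>>],
    hence is orthogonal to [\1_C * Z]. What remains is [p] times the integral of [Z] over [C]. *)
Lemma integral_indep_eq0 (Ga Ge : set (set T)) (Z : T -> R) (A C : set T) :
  <<s Ga >> `<=` measurable -> <<s Ge >> `<=` measurable ->
  indep2 P <<s Ga >> <<s Ge >> ->
  measurable_fun [set: g_sigma_algebraType Ge] (Z : g_sigma_algebraType Ge -> R) ->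
  P.-integrable setT (EFin \o Z) ->
  <<s Ga >> A -> <<s Ge >> C ->
  (\int[P]_(w in C) (Z w)%:E = 0)%E -> (\int[P]_(w in A `&` C) (Z w)%:E = 0)%E.
Proof.
move=> Gam Gem ind mZ iZ GA GC CZ0.
have mA : measurable A by exact: Gam.
have mC : measurable C by exact: Gem.
pose p := fine (P A).
have iC : P.-integrable setT (EFin \o (fun w => \1_C w * Z w)).
  exact: integrable_indicMl.
have iA : P.-integrable setT (EFin \o (\1_A : T -> R)) by exact: integrable_indic.
have ip : P.-integrable setT (EFin \o (cst p : T -> R)).
  exact: finite_measure_integrable_cst.
have iAp : P.-integrable setT (EFin \o (fun w => \1_A w - p)).
  by have := integrableB measurableT iA ip.
have iCA : P.-integrable setT (fun w => (\1_A w * (\1_C w * Z w))%:E).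
  exact: integrable_indicMl.
have ipC : P.-integrable setT (fun w => (p * (\1_C w * Z w))%:E).
  by under eq_fun do rewrite EFinM; exact: integrableZl.
have E0 : (\int[P]_w (\1_C w * Z w * (\1_A w - p))%:E = 0)%E.
  apply: (@integral_mul_eq0 Ge) => //.
  - move=> B GB; have mB := Gem _ GB.
    rewrite integralB_EFin//.
    + rewrite integral_indic// integral_cst//.
      transitivity ((p * fine (P B))%:E - p%:E * (fine (P B))%:E)%E.
        by congr (_ - _ * _)%E; [exact: ind|rewrite fineK// fin_num_measure].
      by rewrite -EFinM subee.
    + exact: integrableS iA.
    + exact: integrableS ip.
  - exact: measurable_funM.
  - have := integrableB measurableT iCA ipC; apply: eq_integrable => // w _.
    by rewrite /= -EFinB; congr EFin; ring.
rewrite integral_indicMl.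
under eq_integral => w _ do rewrite indicI -mulrA.
rewrite -[RHS]E0.
under [RHS]eq_integral => w _.
  rewrite (_ : _ * _ * _ = \1_A w * (\1_C w * Z w) - p * (\1_C w * Z w)); last by ring.
  rewrite EFinB; over.
rewrite /= integralB_EFin// [X in (_ - X)%E](_ : _ = 0%E) ?sube0//.
under eq_integral => w _ do rewrite EFinM.
by rewrite integralZl// -integral_indicMl CZ0 mule0.
Qed.

(* An intersection-stable generator of the join of the two generated sigma-algebras. *)
Definition rectangles (Ga Gs : set (set T)) : set (set T) :=
  [set A | exists B C, [/\ <<s Ga >> B, <<s Gs >> C & A = B `&` C]].

Lemma sub_rectangles_l (Ga Gs : set (set T)) : <<s Ga >> `<=` <<s rectangles Ga Gs >>.
Proof.
move=> A GA; apply: sub_sigma_algebra; exists A, setT; split => //.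
- exact: (@measurableT _ (g_sigma_algebraType Gs)).
- by rewrite setIT.
Qed.

Lemma sub_rectangles_r (Ga Gs : set (set T)) : <<s Gs >> `<=` <<s rectangles Ga Gs >>.
Proof.
move=> A GA; apply: sub_sigma_algebra; exists setT, A; split => //.
- exact: (@measurableT _ (g_sigma_algebraType Ga)).
- by rewrite setTI.
Qed.

(** Enlarging the conditioning by independent information preserves a zero conditional mean: the
    integral of [Z] vanishes on rectangles, then on the sigma-algebra they generate, then against
    its measurable functions. *)
Lemma integral_mul_indep_eq0 (Ga Ge Gs : set (set T)) (Z h : T -> R) :
  <<s Ga >> `<=` measurable -> <<s Ge >> `<=` measurable ->
  <<s Gs >> `<=` <<s Ge >> ->
  indep2 P <<s Ga >> <<s Ge >> ->
  measurable_fun [set: g_sigma_algebraType Ge] (Z : g_sigma_algebraType Ge -> R) ->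
  P.-integrable setT (EFin \o Z) ->
  (forall C, <<s Gs >> C -> (\int[P]_(w in C) (Z w)%:E = 0)%E) ->
  measurable_fun [set: g_sigma_algebraType (rectangles Ga Gs)]
    (h : g_sigma_algebraType (rectangles Ga Gs) -> R) ->
  P.-integrable setT (fun w => (h w * Z w)%:E) ->
  (\int[P]_w (h w * Z w)%:E = 0)%E.
Proof.
move=> Gam Gem Gse ind mZ iZ Z0 mh ihZ.
have rm : rectangles Ga Gs `<=` measurable.
  by move=> _ [B [C [/Gam mB /Gse/Gem mC ->]]]; exact: measurableI.
apply: (@integral_mul_eq0 (rectangles Ga Gs)) => //.
  by apply: smallest_sub => //; exact: sigma_algebra_measurable.
apply: integral_eq0_sigma => //.
- move=> _ _ [A [B [GA GB ->]]] [A' [B' [GA' GB' ->]]].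
  exists (A `&` A'), (B `&` B'); split; [exact: g_sigma_setI|exact: g_sigma_setI|].
  by rewrite setIACA.
- exists setT, setT; split; last by rewrite setIT.
  + exact: (@measurableT _ (g_sigma_algebraType Ga)).
  + exact: (@measurableT _ (g_sigma_algebraType Gs)).
- move=> _ [A [C [GA GC ->]]].
  exact: (integral_indep_eq0 Gam Gem ind mZ iZ GA (Gse _ GC) (Z0 _ GC)).
Qed.

End orthogonality.

(** * One-sided truncation and its exponential bound *)

Definition trunc {R : realType} (y z : R) : R := if z <= y then z else 0.

Lemma trunc_le {R : realType} (y z : R) : 0 <= y -> trunc y z <= y.
Proof. by rewrite /trunc; case: ifP. Qed.

Lemma measurable_trunc d (T : measurableType d) (R : realType) (y : R) (f : T -> R) :
  measurable_fun setT f -> measurable_fun setT (fun w => trunc y (f w)).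
Proof.
move=> mf; apply: measurable_fun_ifT => //.
exact: measurable_fun_ler.
Qed.

(** The right-hand side involves the untruncated [z], so that the moments of the original noise
    apply. Above [y] the left-hand side is 1, and each term on the right is nonnegative because
    [z > y >= 0]. *)
Lemma expR_trunc_le {R : realType} (lam y z : R) : 0 <= lam -> 0 <= y ->
  lam * y < 3 ->
  expR (lam * trunc y z) <= 1 + lam * z + lam ^+ 2 / (2 * (1 - lam * y / 3)) * z ^+ 2.
Proof.
move=> l0 y0 ly; rewrite /trunc; case: ifPn => [zy|].
  apply: le_trans (expR_le_bernstein (ler_wpM2l l0 zy) ly) _.
  by rewrite exprMn mulrAC.
rewrite -ltNge => yz; rewrite mulr0 expR0 -addrA lerDl addr_ge0//.
  by rewrite mulr_ge0// ltW// (le_lt_trans y0).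
rewrite mulr_ge0 ?sqr_ge0// divr_ge0 ?sqr_ge0// mulr_ge0//.
by lra.
Qed.

(** * One step of the exponential supermartingale *)

Section step.
Context (d : measure_display) (T : measurableType d) (R : realType).
Variable P : probability T R.

Lemma integrable_boundedM (h Y : T -> R) (c : R) : measurable_fun setT h ->
  (forall w, `|h w| <= c) -> P.-integrable setT (EFin \o Y) ->
  P.-integrable setT (fun w => (h w * Y w)%:E).
Proof.
move=> mh hc iY.
have mY : measurable_fun setT Y by apply/measurable_EFinP/(measurable_int P).
have icY : P.-integrable setT (fun w => (c * Y w)%:E).
  by under eq_fun do rewrite EFinM; exact: integrableZl.
apply: le_integrable icY => //; first exact/measurable_EFinP/measurable_funM.
move=> w _ /=; rewrite lee_fin !normrM ler_wpM2r//.
by rewrite (le_trans (hc w))// ler_norm.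
Qed.

Lemma integrable_bounded (h : T -> R) (c : R) : measurable_fun setT h ->
  (forall w, `|h w| <= c) -> P.-integrable setT (EFin \o h).
Proof.
move=> mh hc.
have i1 : P.-integrable setT (EFin \o (cst 1 : T -> R)).
  exact: finite_measure_integrable_cst.
have := integrable_boundedM mh hc i1; apply: eq_integrable => // w _.
by rewrite /= mulr1.
Qed.

(** Here [psi] is the exponential of the past, [e] the next noise and [g] its conditional variance.
    In the Bernstein expansion the linear term is orthogonal to the past, [e ^+ 2] may be exchanged
    for [g <= E], and the compensator absorbs the rest. *)
Lemma integral_expR_trunc_le (G : set (set T)) (psi a e g : T -> R) (lam y E M : R) :
  <<s G >> `<=` measurable ->
  measurable_fun [set: g_sigma_algebraType G] (psi : g_sigma_algebraType G -> R) ->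
  measurable_fun [set: g_sigma_algebraType G] (a : g_sigma_algebraType G -> R) ->
  (forall w, 0 <= psi w <= M) -> (forall w, `|a w| <= 1) ->
  P.-integrable setT (EFin \o e) ->
  P.-integrable setT (EFin \o (fun w => e w ^+ 2 - g w)) ->
  (forall w, g w <= E) -> 0 <= E -> 0 <= lam -> 0 <= y -> lam * y < 3 ->
  (forall (h : T -> R),
    measurable_fun [set: g_sigma_algebraType G] (h : g_sigma_algebraType G -> R) ->
    P.-integrable setT (fun w => (h w * e w)%:E) ->
    (\int[P]_w (h w * e w)%:E = 0)%E) ->
  (forall (h : T -> R),
    measurable_fun [set: g_sigma_algebraType G] (h : g_sigma_algebraType G -> R) ->
    P.-integrable setT (fun w => (h w * (e w ^+ 2 - g w))%:E) ->
    (\int[P]_w (h w * (e w ^+ 2 - g w))%:E = 0)%E) ->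
  (\int[P]_w (psi w * expR (lam * trunc y (a w * e w)
      - lam ^+ 2 / (2 * (1 - lam * y / 3)) * E * a w ^+ 2))%:E <=
   \int[P]_w (psi w)%:E)%E.
Proof.
move=> Gm mpsi ma psiM a1 ie iZ gE E0 l0 y0 ly oe oZ.
set D := lam ^+ 2 / _.
have D0 : 0 <= D.
  by rewrite /D divr_ge0 ?sqr_ge0// mulr_ge0//; lra.
(* The compensator depends on the past only; merged with [psi] it gives bounded test functions
   [q * a] and [q * a ^+ 2]. *)
pose q w := psi w * expR (- (D * E * a w ^+ 2)).
have mq : measurable_fun [set: g_sigma_algebraType G] (q : g_sigma_algebraType G -> R).
  apply: measurable_funM => //; apply: measurableT_comp => //.
  apply: measurable_funN; apply: measurable_funM => //.
  exact: measurable_funX.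
have mqa : measurable_fun [set: g_sigma_algebraType G]
    ((fun w => q w * a w) : g_sigma_algebraType G -> R).
  exact: measurable_funM.
have mqaa : measurable_fun [set: g_sigma_algebraType G]
    ((fun w => q w * a w ^+ 2) : g_sigma_algebraType G -> R).
  by apply: measurable_funM => //; exact: measurable_funX.
have q0 w : 0 <= q w <= psi w.
  have /andP[p0 _] := psiM w.
  rewrite mulr_ge0 ?expR_ge0//= ler_piMr// -expR0 ler_expR oppr_le0.
  by apply: mulr_ge0; rewrite ?sqr_ge0// mulr_ge0.
have qM w : `|q w| <= M.
  have /andP[? qp] := q0 w; have /andP[_ pM] := psiM w.
  by rewrite ger0_norm// (le_trans qp).
have M0 : 0 <= M by rewrite (le_trans _ (qM point)).
have qaM w : `|q w * a w| <= M.
  by rewrite normrM -[leRHS]mulr1 ler_pM.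
have qaaM w : `|q w * a w ^+ 2| <= M.
  by rewrite normrM -[leRHS]mulr1 ler_pM// normrX exprn_ile1.
have sub (f : T -> R) := @measurable_fun_g_sigma _ _ R G f Gm.
have iqe := integrable_boundedM (sub _ mqa) qaM ie.
have iqZ := integrable_boundedM (sub _ mqaa) qaaM iZ.
have me : measurable_fun setT e by apply/measurable_EFinP/(measurable_int P).
have ipsi : P.-integrable setT (EFin \o psi).
  apply: (@integrable_bounded _ M); first exact: sub.
  by move=> w; have /andP[? ?] := psiM w; rewrite ger0_norm.
have iqe' : P.-integrable setT (EFin \o (fun w => lam * (q w * a w * e w))).
  by have := integrableZl measurableT lam iqe.
have iqZ' : P.-integrable setT
    (EFin \o (fun w => D * (q w * a w ^+ 2 * (e w ^+ 2 - g w)))).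
  by have := integrableZl measurableT D iqZ.
have iR : P.-integrable setT (EFin \o (fun w => psi w + lam * (q w * a w * e w))).
  by have := integrableD measurableT ipsi iqe'.
have iR' : P.-integrable setT (EFin \o (fun w => psi w + lam * (q w * a w * e w) +
    D * (q w * a w ^+ 2 * (e w ^+ 2 - g w)))).
  by have := integrableD measurableT iR iqZ'.
(* The intermediate integrand is [psi] plus two terms of zero integral. *)
apply: (@le_trans _ _ (\int[P]_w (psi w + lam * (q w * a w * e w) +
    D * (q w * a w ^+ 2 * (e w ^+ 2 - g w)))%:E)%E); last first.
  rewrite integralD_EFin// integralD_EFin//=.
  under [X in (_ + X + _)%E]eq_integral do rewrite EFinM.
  under [X in (_ + _ + X)%E]eq_integral do rewrite EFinM.
  by rewrite !integralZl// oe// oZ// !mule0 !adde0.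
have mma : measurable_fun setT a by exact: sub.
have lhs0 w : 0 <= psi w * expR (lam * trunc y (a w * e w) - D * E * a w ^+ 2).
  by rewrite mulr_ge0 ?expR_ge0//; have /andP[] := psiM w.
have ptw w : psi w * expR (lam * trunc y (a w * e w) - D * E * a w ^+ 2) <=
    psi w + lam * (q w * a w * e w) + D * (q w * a w ^+ 2 * (e w ^+ 2 - g w)).
  have /andP[qw0 _] := q0 w.
  (* This is [1 + s <= expR s] at [s = D * E * a w ^+ 2]. *)
  have qpsi : q w * (1 + D * E * a w ^+ 2) <= psi w.
    rewrite /q -mulrA ler_piMr//; first by have /andP[] := psiM w.
    by rewrite expRN ler_pdivrMl ?expR_gt0// mulr1 expR_ge1Dx.
  have -> : psi w * expR (lam * trunc y (a w * e w) - D * E * a w ^+ 2) =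
      q w * expR (lam * trunc y (a w * e w)) by rewrite expRD mulrCA mulrC.
  apply: le_trans (ler_wpM2l qw0 (expR_trunc_le (a w * e w) l0 y0 ly)) _.
  rewrite -/D.
  have : D * (q w * a w ^+ 2 * g w) <= D * (q w * a w ^+ 2 * E).
    by rewrite !ler_wpM2l// mulr_ge0// sqr_ge0.
  move: qpsi; move: (q w) (a w) (e w) (g w) => q' a' e' g'.
  by move: (psi w) => p' h1 h2; lra.
apply: ge0_le_integral => //.
- by move=> w _; rewrite lee_fin.
- apply/measurable_EFinP/measurable_funM; first exact: sub.
  apply: measurableT_comp => //; apply: measurable_funB; apply: measurable_funM => //.
    by apply: measurable_trunc; exact: measurable_funM.
  exact: measurable_funX.
- exact: (measurable_int P).
by move=> w _; rewrite lee_fin.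
Qed.
End step.

(** * Generated sigma-algebras and conditional variances *)

Section model.
Context (d : measure_display) (T : measurableType d) (R : realType).
Variable P : probability T R.
Implicit Types (J : set nat) (f phi eps : nat -> T -> R) (G : set (set T)).

(** The generators of [gen_sigma], named separately so that [g_sigma_algebraType] can be formed from
    them. *)
Definition gens J f : set (set T) :=
  [set A | exists j B, J j /\ measurable B /\ A = f j @^-1` B].

Lemma measurable_fun_gens J f j : J j ->
  measurable_fun [set: g_sigma_algebraType (gens J f)]
    (f j : g_sigma_algebraType (gens J f) -> R).
Proof.
move=> Jj _ B mB; rewrite setTI; apply: sub_sigma_algebra.
by exists j, B.
Qed.

Lemma sub_gens_measurable J f :
  (forall j, J j -> measurable_fun setT (f j)) -> <<s gens J f >> `<=` measurable.
Proof.
move=> mf; apply: smallest_sub; first exact: sigma_algebra_measurable.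
by move=> _ [j [B [Jj [mB ->]]]]; rewrite -[_ @^-1` _]setTI; exact: mf.
Qed.

Lemma sub_gens J J' f : J `<=` J' -> <<s gens J f >> `<=` <<s gens J' f >>.
Proof.
move=> JJ'; apply: smallest_sub; first exact: smallest_sigma_algebra.
move=> _ [j [B [Jj [mB ->]]]]; apply: sub_sigma_algebra.
by exists j, B; split => //; exact: JJ'.
Qed.

Lemma measurable_fun_sub_sigma G G' (h : T -> R) : <<s G >> `<=` <<s G' >> ->
  measurable_fun [set: g_sigma_algebraType G] (h : g_sigma_algebraType G -> R) ->
  measurable_fun [set: g_sigma_algebraType G'] (h : g_sigma_algebraType G' -> R).
Proof. by move=> GG' mh mT B mB; apply: GG'; exact: mh. Qed.

(** Turns the conditional variance into an orthogonality relation for [X ^+ 2 - g']. Measurability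
    of [g'] is stated for the larger [Ge], the sigma-algebra to which independence will be
    applied. *)
Lemma cond_exp_eq0 (G Ge : set (set T)) (X g : T -> R) (E : R) :
  <<s Ge >> `<=` measurable -> <<s G >> `<=` <<s Ge >> ->
  measurable_fun setT X ->
  is_cond_exp P <<s G >> (fun w => X w ^+ 2) g -> {ae P, forall w, g w <= E} ->
  exists g' : T -> R, [/\
    measurable_fun [set: g_sigma_algebraType Ge] (g' : g_sigma_algebraType Ge -> R),
    forall w, g' w <= E,
    P.-integrable setT (EFin \o (fun w => X w ^+ 2 - g' w)) &
    forall C, <<s G >> C -> (\int[P]_(w in C) (X w ^+ 2 - g' w)%:E = 0)%E].
Proof.
move=> Gem GGe mX [mg ig gX] gE.
have mg1 : measurable_fun [set: g_sigma_algebraType Ge] (g : g_sigma_algebraType Ge -> R).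
  by move=> _ B mB; rewrite setTI; apply: GGe; exact: mg.
(* Truncating at E changes g on a null set only and makes the bound hold everywhere. *)
pose g' w := Num.min (g w) E.
have mg' : measurable_fun [set: g_sigma_algebraType Ge] (g' : g_sigma_algebraType Ge -> R).
  exact: measurable_minr.
have mg'T : measurable_fun setT g' by exact: measurable_fun_g_sigma mg'.
have mgT : measurable_fun setT g by exact: measurable_fun_g_sigma mg1.
have mX2 : measurable_fun setT (fun w => X w ^+ 2) by exact: measurable_funX.
have gg' : ae_eq P setT (EFin \o g) (EFin \o g').
  by apply: filterS gE => w gwE _ /=; rewrite /g' min_l.
have ig' : P.-integrable setT (EFin \o g').
  apply/integrableP; split; first exact/measurable_EFinP.
  have -> : (\int[P]_w `|(EFin \o g') w| = \int[P]_w `|(EFin \o g) w|)%E.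
    apply: ae_eq_integral => //.
    - by do 2 apply: measurableT_comp => //.
    - by do 2 apply: measurableT_comp => //.
    - by apply: filterS gg' => w h Tw; rewrite h.
  by case/integrableP : ig.
have TG : <<s G >> setT by exact: (@measurableT _ (g_sigma_algebraType G)).
(* The defining identity on the whole space equates the integral of [X ^+ 2] with that of [g], which
   is finite. *)
have iX2 : P.-integrable setT (EFin \o (fun w => X w ^+ 2)).
  apply/integrableP; split; first exact/measurable_EFinP.
  under eq_integral => w _ do rewrite /= ger0_norm ?sqr_ge0//.
  rewrite -gX//.
  by have := integrable_lty measurableT ig.
exists g'; split => //.
- by move=> w; rewrite /g' ge_min lexx orbT.
- by have := integrableB measurableT iX2 ig'.
- move=> C GC; have mC : measurable C by apply: Gem; exact: GGe.
  rewrite integralB_EFin//; [|exact: integrableS iX2|exact: integrableS ig'].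
  have -> : (\int[P]_(w in C) (g' w)%:E = \int[P]_(w in C) (g w)%:E)%E.
    apply: ae_eq_integral => //.
    + apply/measurable_EFinP; exact: measurable_funTS.
    + apply/measurable_EFinP; exact: measurable_funTS.
    + by apply: filterS gg' => w h _; symmetry; exact: h.
  rewrite -gX// subee//; apply: integrable_fin_num => //; exact: integrableS ig.
Qed.

(** The nonnegative function [E + (X w ^+ 2 - g w)] has integral [E]. *)
Lemma cond_exp_bound_ge0 (X g : T -> R) (E : R) :
  P.-integrable setT (EFin \o (fun w => X w ^+ 2 - g w)) ->
  (forall w, g w <= E) -> (\int[P]_w (X w ^+ 2 - g w)%:E = 0)%E -> 0 <= E.
Proof.
move=> iZ gE Z0.
have iE : P.-integrable setT (EFin \o (cst E : T -> R)).
  exact: finite_measure_integrable_cst.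
have : (0 <= \int[P]_w (E + (X w ^+ 2 - g w))%:E)%E.
  apply: integral_ge0 => w _; rewrite lee_fin addrCA addr_ge0 ?sqr_ge0// subr_ge0.
  exact: gE.
rewrite integralD_EFin// Z0 adde0 integral_cst//.
by rewrite [X in (_ * X)%E](@probability_setT _ _ _ P) mule1 lee_fin.
Qed.

Lemma measurable_sum_nat d' (U : measurableType d') (h : nat -> U -> R) m n :
  (forall j, (m <= j < n)%N -> measurable_fun setT (h j)) ->
  measurable_fun setT (fun w => \sum_(m <= j < n) h j w).
Proof.
move=> mh.
rewrite (_ : (fun w => _) =
    fun w => \sum_(m <= j < n) (if (m <= j < n)%N then h j w else 0)).
  apply: measurable_sum => j; case: (boolP (m <= j < n)%N) => // H; exact: mh.
by apply/funext => w; apply: eq_big_nat => j mjn; rewrite mjn.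
Qed.

End model.

(** * The exponential supermartingale of the weighted noise *)

Section tail.
Context (d : measure_display) (T : measurableType d) (R : realType).
Variable P : probability T R.
Implicit Types (phi eps : nat -> T -> R).

Let idx n := [set k : nat | (1 <= k <= n)%N].

(** The constant [D * E]: it bounds the total compensator when the squared weights sum to at most
    1. *)
Definition drift (E lam y : R) : R := lam ^+ 2 / (2 * (1 - lam * y / 3)) * E.

Definition log_increment (E lam y : R) (a eps : nat -> T -> R) (j : nat) (w : T) : R :=
  lam * trunc y (a j w * eps j w) - drift E lam y * a j w ^+ 2.

Lemma log_increment_le E lam y a eps j w : 0 <= E -> 0 <= lam -> 0 <= y ->
  lam * y < 3 -> log_increment E lam y a eps j w <= lam * y.
Proof.
move=> E0 l0 y0 ly; rewrite /log_increment lerBlDr ler_wpDr//.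
  by rewrite mulr_ge0 ?sqr_ge0// mulr_ge0// divr_ge0 ?sqr_ge0// mulr_ge0//; lra.
by rewrite ler_wpM2l// trunc_le.
Qed.

Lemma regression_bound_ge0 n phi eps alpha E F :
  regression_hyp P n.+1 phi eps alpha E F -> 0 <= E.
Proof.
move=> [_ [meps [_ [_ [_ [/(_ 1%N isT) [g [ce gE]] _]]]]]].
have Gem : <<s gens (idx n.+1) eps >> `<=` measurable by exact: sub_gens_measurable.
have [|g' [mg' g'E iZ Z0]] := cond_exp_eq0 Gem _ (meps 1%N isT) ce gE.
  by apply: sub_gens => j /= /andP[j1 j0]; rewrite /idx/= j1 (leq_trans j0).
apply: cond_exp_bound_ge0 iZ g'E _; apply: Z0.
exact: (@measurableT _ (g_sigma_algebraType _)).
Qed.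

(** Induction on [k]: conditionally on all of [phi] and the first [k] noises, the next factor has
    mean at most 1. *)
Lemma integral_supermartingale_le1 n phi eps (a : nat -> T -> R) alpha E F lam y :
  regression_hyp P n phi eps alpha E F ->
  (forall k, (1 <= k <= n)%N ->
    measurable_fun [set: g_sigma_algebraType (gens (idx n) phi)]
      (a k : g_sigma_algebraType (gens (idx n) phi) -> R)) ->
  (forall k w, (1 <= k <= n)%N -> `|a k w| <= 1) ->
  0 <= lam -> 0 <= y -> lam * y < 3 ->
  forall k, (k <= n)%N ->
  (\int[P]_w (expR (\sum_(1 <= j < k.+1) log_increment E lam y a eps j w))%:E <= 1)%E.
Proof.
move=> H ma a1 l0 y0 ly.
have E0 : (0 < n)%N -> 0 <= E.
  by case: n H {ma a1} => // n H _; exact: regression_bound_ge0 H.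
case: H => [mphi [meps [_ [ind [mart [cvar _]]]]]].
have Gam : <<s gens (idx n) phi >> `<=` measurable by exact: sub_gens_measurable.
have Gem : <<s gens (idx n) eps >> `<=` measurable by exact: sub_gens_measurable.
elim=> [_|k IH kn].
  under eq_integral => w _ do rewrite big_geq// expR0.
  rewrite integral_cst// mul1e.
  by rewrite [leLHS](@probability_setT _ _ _ P).
have {}E0 : 0 <= E by apply: E0; exact: leq_trans kn.
have k1n : (1 <= k.+1 <= n)%N by [].
apply: le_trans (IH (ltnW kn)).
under eq_integral => w _ do rewrite big_nat_recr//= expRD.
(* At index [k.+1] the past [i.-1] of the hypotheses computes to [k]. *)
pose Gs := gens (idx k) eps.
have Gse : <<s Gs >> `<=` <<s gens (idx n) eps >>.
  by apply: sub_gens => j /= /andP[j1 jk]; rewrite /idx/= j1 (leq_trans jk)// ltnW.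
have [ie [_ _ e0]] := mart _ k1n.
have [g [ce gE]] := cvar _ k1n.
have [g' [mg' g'E iZ Z0]] := cond_exp_eq0 Gem Gse (meps _ k1n) ce gE.
have me := @measurable_fun_gens _ _ _ (idx n) eps k.+1 k1n.
(* All of [phi] must be included from the start, since the weights are allowed to depend on every
   [phi j]. *)
pose G := rectangles (gens (idx n) phi) Gs.
have Gm : <<s G >> `<=` measurable.
  apply: smallest_sub; first exact: sigma_algebra_measurable.
  by move=> _ [B [C [/Gam mB /Gse/Gem mC ->]]]; exact: measurableI.
have maG j : (1 <= j <= n)%N -> measurable_fun [set: g_sigma_algebraType G]
    (a j : g_sigma_algebraType G -> R).
  by move=> jn; apply: measurable_fun_sub_sigma (ma _ jn); exact: sub_rectangles_l.
have meG j : (1 <= j < k.+1)%N -> measurable_fun [set: g_sigma_algebraType G]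
    (eps j : g_sigma_algebraType G -> R).
  move=> jk; have := @measurable_fun_gens _ _ _ (idx k) eps j jk.
  by apply: measurable_fun_sub_sigma; exact: sub_rectangles_r.
apply: (@integral_expR_trunc_le _ _ _ P G _ _ _ g' _ _ _
  (expR (\sum_(1 <= j < k.+1) lam * y))) => //.
- apply: measurableT_comp => //.
  apply: measurable_sum_nat => j jk.
  have jn : (1 <= j <= n)%N.
    by move/andP: jk => [-> jk] /=; rewrite (leq_trans _ kn)// ltnW.
  apply: measurable_funB; apply: measurable_funM => //.
    by apply: measurable_trunc; apply: measurable_funM; [exact: maG|exact: meG].
  by apply: measurable_funX; exact: maG.
- exact: maG.
- move=> w; rewrite expR_ge0/= ler_expR; apply: ler_sum_nat => j _.
  exact: log_increment_le.
- by move=> w; exact: a1.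
- move=> h mh ihe; apply: (integral_mul_indep_eq0 Gam Gem Gse ind) => //.
  by move=> C GC; rewrite -e0// integral0.
- move=> h mh ihZ; apply: (integral_mul_indep_eq0 Gam Gem Gse ind) => //.
  apply: measurable_funB => //; exact: measurable_funX.
Qed.

End tail.

(** For [E > 0], [lam = x / (E + x * y / 3)] gives [1 - lam * y / 3 = E / (E + x * y / 3)], and the
    last inequality is an equality. *)
Lemma optimal_parameter {R : realType} (E x y : R) : 0 <= E -> 0 < x -> 0 < y ->
  exists lam : R, [/\ 0 <= lam, lam * y < 3 &
    drift E lam y - lam * x <= - (x ^+ 2 / (2 * (E + x * y / 3)))].
Proof.
move=> E0 x0 y0; have xy0 : 0 < x * y by rewrite mulr_gt0.
move: E0; rewrite le_eqVlt => /orP[/eqP <-|E0].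
  (* The value [x / (E + x * y / 3)] would give [lam * y = 3]. *)
  exists (3 / (2 * y)); split.
  - by rewrite divr_ge0// ltW// mulr_gt0.
  - rewrite [ltLHS](_ : _ = 3 / 2); first by lra.
    by field; rewrite gt_eqF.
  - rewrite /drift mulr0 sub0r lerN2 add0r le_eqVlt; apply/orP; left; apply/eqP.
    by field; rewrite !gt_eqF.
have s0 : 0 < E + x * y / 3 by rewrite addr_gt0// divr_gt0.
exists (x / (E + x * y / 3)); split.
- by rewrite divr_ge0// ltW.
- rewrite mulrAC ltr_pdivrMr//; lra.
- rewrite /drift le_eqVlt; apply/orP; left; apply/eqP; field.
  by rewrite addrK !gt_eqF ?addr_gt0 ?mulr_gt0.
Qed.

(** * From the supermartingale to a tail bound *)

Section tail_bound.
Context (d : measure_display) (T : measurableType d) (R : realType).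
Variable P : probability T R.
Implicit Types (phi eps : nat -> T -> R).

Lemma ge0_integral_sum_nat_le (h : nat -> T -> R) (n : nat) (c : R) :
  (forall k, (1 <= k <= n)%N -> measurable_fun setT (h k)) ->
  (forall k w, 0 <= h k w) ->
  (forall k, (1 <= k <= n)%N -> (\int[P]_w (h k w)%:E <= c%:E)%E) ->
  (\int[P]_w (\sum_(1 <= k < n.+1) h k w)%:E <= (n%:R * c)%:E)%E.
Proof.
move=> mh h0 hc; elim: n mh hc => [|n IH] mh hc.
  under eq_integral => w _ do rewrite big_geq//.
  by rewrite integral0 mul0r.
have lt k : (1 <= k <= n)%N -> (1 <= k <= n.+1)%N.
  by move=> /andP[-> kn] /=; exact: leqW.
under eq_integral => w _ do rewrite big_nat_recr//= EFinD.
rewrite ge0_integralD//; last first.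
- by apply/measurable_EFinP; apply: mh; rewrite /= leqnn.
- by move=> w _; rewrite lee_fin.
- by apply/measurable_EFinP; apply: measurable_sum_nat => k kn; apply: mh; exact: lt.
- by move=> w _; rewrite lee_fin sumr_ge0.
rewrite -natr1 mulrDl mul1r EFinD leeD//.
  by apply: IH => k /lt kn; [exact: mh|exact: hc].
by apply: hc; rewrite /= leqnn.
Qed.

Lemma tail_bound n phi eps (a : nat -> T -> R) alpha E F lam x y :
  regression_hyp P n phi eps alpha E F -> (0 < n)%N ->
  (forall k, (1 <= k <= n)%N ->
    measurable_fun [set: g_sigma_algebraType (gens [set k | (1 <= k <= n)%N] phi)]
      (a k : g_sigma_algebraType (gens [set k | (1 <= k <= n)%N] phi) -> R)) ->
  (forall w, \sum_(1 <= k < n.+1) a k w ^+ 2 <= 1) ->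
  0 < alpha < 1 -> 0 <= lam -> 0 <= y -> lam * y < 3 ->
  (P [set w | (x <= \sum_(1 <= k < n.+1) a k w * eps k w)%R] <=
   (expR (drift E lam y - lam * x) +
    n%:R * F * expR (- y `^ (alpha / (1 - alpha))))%:E)%E.
Proof.
move=> H n0 ma a1 /andP[al0 al1] l0 y0 ly.
have E0 : 0 <= E by case: n n0 H {ma a1} => // n _; exact: regression_bound_ge0.
have [mphi [meps [_ [_ [_ [_ [expmom _]]]]]]] := H.
have ak1 k w : (1 <= k <= n)%N -> `|a k w| <= 1.
  move=> kn; rewrite -(@ler_pXn2r _ 2%N) ?nnegrE// real_normK ?num_real// expr1n.
  apply: le_trans (a1 w); rewrite (bigD1_seq k) ?iota_uniq ?mem_index_iota//=.
  by rewrite lerDl sumr_ge0// => j _; exact: sqr_ge0.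
have mart := integral_supermartingale_le1 H ma ak1 l0 y0 ly (leqnn n).
set f := fun w => \sum_(1 <= k < n.+1) a k w * eps k w.
have Gam : <<s gens [set k | (1 <= k <= n)%N] phi >> `<=` measurable.
  exact: sub_gens_measurable.
have maT k : (1 <= k <= n)%N -> measurable_fun setT (a k).
  by move=> /ma; exact: measurable_fun_g_sigma.
have mf : measurable_fun setT f.
  by apply: measurable_sum_nat => k kn; apply: measurable_funM; [exact: maT|exact: meps].
have mA : measurable [set w | (x <= f w)%R].
  rewrite [X in measurable X](_ : _ = f @^-1` `[x, +oo[).
    by rewrite -[_ @^-1` _]setTI; exact: mf.
  by apply/seteqP; split => w; rewrite /= in_itv/= andbT.
pose gam := alpha / (1 - alpha).
have gam0 : 0 <= gam by rewrite divr_ge0 ?subr_ge0// ltW.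
pose M w := expR (\sum_(1 <= j < n.+1) log_increment E lam y a eps j w).
pose r1 := expR (drift E lam y - lam * x).
pose r2 := expR (- y `^ gam).
have mM : measurable_fun setT M.
  apply: measurableT_comp => //; apply: measurable_sum_nat => j jn.
  apply: measurable_funB; apply: measurable_funM => //.
    by apply: measurable_trunc; apply: measurable_funM; [exact: maT|exact: meps].
  by apply: measurable_funX; exact: maT.
have mX k : (1 <= k <= n)%N -> measurable_fun setT (fun w => expR (`|eps k w| `^ gam)).
  move=> kn; apply: measurableT_comp => //.
  apply: (@measurableT_comp _ _ _ _ _ _ (@powR R ^~ gam)); first exact: measurable_powR.
  by apply: measurableT_comp => //; exact: meps.
(* Markov's inequality and the union bound at once: the indicator is dominated pointwise, and
   integrating the right-hand side yields both terms. *)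
have ptw w : \1_[set w | (x <= f w)%R] w <=
    r1 * M w + \sum_(1 <= k < n.+1) r2 * expR (`|eps k w| `^ gam).
  have s0 : 0 <= \sum_(1 <= k < n.+1) r2 * expR (`|eps k w| `^ gam).
    by apply: sumr_ge0 => k _; rewrite mulr_ge0// expR_ge0.
  have rM0 : 0 <= r1 * M w by rewrite mulr_ge0// expR_ge0.
  rewrite indicE; have [|_] := boolP (w \in _); last by rewrite addr_ge0.
  rewrite inE /= => xf.
  have [small|] := boolP (all (fun k => a k w * eps k w <= y) (index_iota 1 n.+1)).
    (* No term is truncated here, so the exponent of [M] is [lam * f w] minus at most the drift. *)
    rewrite ler_wpDr// /r1 /M -expRD -expR0 ler_expR.
    have -> : \sum_(1 <= j < n.+1) log_increment E lam y a eps j w =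
        lam * f w - drift E lam y * \sum_(1 <= j < n.+1) a j w ^+ 2.
      rewrite /f !big_distrr/= -sumrB; apply: eq_big_seq => j jn.
      by rewrite /log_increment /trunc (allP small _ jn).
    have d0 : 0 <= drift E lam y.
      by rewrite /drift mulr_ge0// divr_ge0 ?sqr_ge0// mulr_ge0//; lra.
    have := ler_wpM2l d0 (a1 w); have := ler_wpM2l l0 xf.
    by rewrite mulr1; lra.
  (* As [|a k w| <= 1], a product above [y] forces [|eps k w| > y], and the summand of index [k]
     alone is at least 1. *)
  case/allPn => k; rewrite mem_index_iota -ltNge => kn yk.
  rewrite ler_wpDl// (bigD1_seq k) ?iota_uniq ?mem_index_iota//= ler_wpDr//.
    by apply: sumr_ge0 => j _; rewrite mulr_ge0// expR_ge0.
  rewrite /r2 -expRD -expR0 ler_expR addrC subr_ge0.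
  apply: ge0_ler_powR; rewrite ?nnegrE// (le_trans (ltW yk))//.
  rewrite (le_trans (ler_norm _))// normrM ler_piMl//.
  exact: ak1.
have mS : measurable_fun setT
    (fun w => \sum_(1 <= k < n.+1) r2 * expR (`|eps k w| `^ gam)).
  by apply: measurable_sum_nat => k kn; apply: measurable_funM => //; exact: mX.
have -> : (P [set w | (x <= f w)%R] =
    \int[P]_w (\1_[set w | (x <= f w)%R] w)%:E)%E by rewrite integral_indic// setIT.
apply: (@le_trans _ _ (\int[P]_w (r1 * M w +
    \sum_(1 <= k < n.+1) r2 * expR (`|eps k w| `^ gam))%:E)%E).
  apply: ge0_le_integral => //.
  - by apply/measurable_EFinP.
  - by apply/measurable_EFinP/measurable_funD => //; exact: measurable_funM.
  - by move=> w _; rewrite lee_fin.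
under eq_integral => w _ do rewrite EFinD.
rewrite ge0_integralD//; last first.
- exact/measurable_EFinP.
- by move=> w _; rewrite lee_fin sumr_ge0// => k _; rewrite mulr_ge0// expR_ge0.
- by apply/measurable_EFinP/measurable_funM.
- by move=> w _; rewrite lee_fin mulr_ge0// expR_ge0.
rewrite EFinD leeD//.
  under eq_integral => w _ do rewrite EFinM.
  rewrite ge0_integralZl//; last 3 first.
  - exact/measurable_EFinP.
  - by move=> w _; rewrite lee_fin expR_ge0.
  - by rewrite lee_fin expR_ge0.
  by rewrite -[leRHS]mule1 lee_wpmul2l// lee_fin expR_ge0.
rewrite -mulrA; apply: ge0_integral_sum_nat_le.
- by move=> k kn; apply: measurable_funM => //; exact: mX.
- by move=> k w; rewrite mulr_ge0// expR_ge0.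
move=> k kn; under eq_integral => w _ do rewrite EFinM.
rewrite ge0_integralZl//; last 2 first.
- by apply/measurable_EFinP; exact: mX.
- by rewrite lee_fin expR_ge0.
by rewrite mulrC EFinM lee_wpmul2l ?lee_fin ?expR_ge0//; exact: expmom.
Qed.

End tail_bound.

(** * The estimation error as a weighted sum of the noise *)

Section regression.
Context (d : measure_display) (T : measurableType d) (R : realType).
Implicit Types (phi eps : nat -> T -> R).

(* Where [sumsq] vanishes, [0 `^ (- 2^-1) = 0] agrees with the junk value [0] of [thetan],
   so the identity [self_normalized] needs no positivity assumption. *)
Definition weight (b : bool) n phi (k : nat) (w : T) : R :=
  (-1) ^+ b * (phi k w * sumsq n phi w `^ (- 2^-1)).

Lemma sumsq_ge0 n phi w : 0 <= sumsq n phi w.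
Proof. by apply: sumr_ge0 => k _; exact: sqr_ge0. Qed.

Lemma measurable_weight b n phi k : (1 <= k <= n)%N ->
  measurable_fun [set: g_sigma_algebraType (gens [set k | (1 <= k <= n)%N] phi)]
    (weight b n phi k : g_sigma_algebraType (gens [set k | (1 <= k <= n)%N] phi) -> R).
Proof.
move=> kn; apply: measurable_funM => //; apply: measurable_funM.
  exact: measurable_fun_gens.
apply: (@measurableT_comp _ _ _ _ _ _ (@powR R ^~ _)); first exact: measurable_powR.
set G := gens _ _.
apply: (@measurable_sum_nat R _ (g_sigma_algebraType G)) => j jn.
by apply: measurable_funX; exact: measurable_fun_gens.
Qed.

(** The sum is 1 where [sumsq] is positive and 0 where it vanishes. *)
Lemma sum_sqr_weight_le1 b n phi w : \sum_(1 <= k < n.+1) weight b n phi k w ^+ 2 <= 1.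
Proof.
under eq_bigr do rewrite /weight !exprMn sqrr_sign mul1r.
rewrite -big_distrl/= -/(sumsq n phi w) powRN powR12_sqrt ?sumsq_ge0//.
rewrite exprVn sqr_sqrtr ?sumsq_ge0//.
by have [->|s0] := eqVneq (sumsq n phi w) 0; rewrite ?mul0r// divff.
Qed.

Lemma self_normalized (b : bool) n theta phi eps w :
  (-1) ^+ b * (thetan n theta phi eps w - theta) * Num.sqrt (sumsq n phi w) =
  \sum_(1 <= k < n.+1) weight b n phi k w * eps k w.
Proof.
transitivity ((-1) ^+ b * sumsq n phi w `^ (- 2^-1) *
    \sum_(1 <= k < n.+1) phi k w * eps k w); last first.
  by rewrite big_distrr/=; apply: eq_bigr => k _; rewrite /weight; ring.
rewrite powRN powR12_sqrt ?sumsq_ge0//.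
have : 0 <= sumsq n phi w := sumsq_ge0 _ _ _.
rewrite le_eqVlt => /orP[/eqP <-|s0]; first by rewrite sqrtr0 invr0 !(mulr0, mul0r).
rewrite -!mulrA; congr (_ * _); rewrite /thetan /regX.
have -> : \sum_(1 <= k < n.+1) phi k w * (theta * phi k w + eps k w) =
    theta * sumsq n phi w + \sum_(1 <= k < n.+1) phi k w * eps k w.
  by rewrite /sumsq big_distrr -big_split/=; apply: eq_bigr => k _; ring.
(* Used with [r] the square root of [sumsq], so that the remaining identity is rational in [r]. *)
have alg (r S : R) : 0 < r -> ((theta * r ^+ 2 + S) / r ^+ 2 - theta) * r = r^-1 * S.
  by move=> r0; field; rewrite gt_eqF.
by rewrite -[RHS]alg ?sqrtr_gt0// sqr_sqrtr ?ltW.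
Qed.

End regression.

(** * The explicit tail bound and its asymptotic form *)

Lemma expR_natM_le {R : realType} (alpha kappa : R) : 0 < alpha -> 0 < kappa ->
  exists2 C : R, 0 <= C & forall n : nat, (0 < n)%N ->
    n%:R <= C * expR (kappa * n%:R `^ (alpha / 2)).
Proof.
move=> al0 k0.
(* As [m > 2 / alpha] and [t >= 1], [n = t ^ (2 / alpha)] is at most [t ^ (m + 1)], which one term
   of the exponential series in [kappa * t] controls. *)
pose m := Num.bound (2 / alpha).
exists (m.+1`!%:R / kappa ^+ m.+1).
  by rewrite divr_ge0// exprn_ge0// ltW.
move=> n n0; set t := n%:R `^ (alpha / 2).
have t1 : 1 <= t.
  rewrite /t -[leLHS](@powRr0 R n%:R); apply: ler_powR; first by rewrite ler1n.
  by rewrite divr_ge0// ltW.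
have nt : n%:R = t `^ (2 / alpha).
  rewrite /t -powRrM (_ : _ * _ = 1) ?powRr1//.
  by field; rewrite gt_eqF.
have : t `^ (2 / alpha) <= t ^+ m.+1.
  rewrite -powR_mulrn ?(le_trans ler01)//; apply: ler_powR => //.
  have al2 : 0 <= 2 / alpha by rewrite divr_ge0// ltW.
  apply/ltW/(lt_le_trans (archi_boundP al2)).
  by rewrite ler_nat leqnSn.
rewrite -nt => /le_trans; apply.
have kt : 0 <= kappa * t by rewrite mulr_ge0 ?powR_ge0// ltW.
have h : (kappa * t) ^+ m.+1 <= expR (kappa * t) * m.+1`!%:R.
  rewrite -ler_pdivrMr ?ltr0n ?fact_gt0//.
  by rewrite (le_trans _ (expR_ge1Dxn m kt))// lerDr.
by rewrite mulrAC ler_pdivlMr ?exprn_gt0// [leLHS]mulrC -exprMn [leRHS]mulrC.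
Qed.

Lemma self_normalized_tail (d : measure_display) (T : measurableType d) (R : realType)
    (P : probability T R) (theta alpha E F : R) (n : nat) (phi eps : nat -> T -> R)
    (b : bool) (x : R) :
  0 < alpha < 1 -> regression_hyp P n phi eps alpha E F -> 0 < x ->
  (P [set w | (x <= (-1) ^+ b * (thetan n theta phi eps w - theta)
                                  * Num.sqrt (sumsq n phi w))%R]
   <= (expR (- (x ^+ 2 / (2 * (E + x `^ (2 - alpha) / 3))))
            + n%:R * F * expR (- x `^ alpha))%R%:E)%E.
Proof.
move=> al01 H x0; have /andP[al0 al1] := al01.
rewrite (_ : [set w | _] =
    [set w | (x <= \sum_(1 <= k < n.+1) weight b n phi k w * eps k w)%R]); last first.
  by apply/seteqP; split => w; rewrite /= self_normalized.
have [n0|n0] := posnP n.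
  (* For [n = 0] the sum is empty, so it cannot reach [x > 0]. *)
  rewrite n0 (_ : [set w | _] = set0); last first.
    by rewrite -subset0 => w /=; rewrite big_geq// leNgt x0.
  by rewrite measure0 lee_fin mul0r mul0r addr0 expR_ge0.
have E0 : 0 <= E by case: n n0 H => // n _; exact: regression_bound_ge0.
(* This level turns the moment exponent into [x ^ alpha] and the Bernstein term [x * y] into
   [x ^ (2 - alpha)]. *)
pose y := x `^ (1 - alpha).
have y0 : 0 < y by exact: powR_gt0.
have yE : y `^ (alpha / (1 - alpha)) = x `^ alpha.
  rewrite /y -powRrM; congr (_ `^ _); field.
  by rewrite subr_eq0 gt_eqF.
have xyE : x * y = x `^ (2 - alpha).
  rewrite /y -{1}(powRr1 (ltW x0)) -powRD; last by rewrite (gt_eqF x0) implybT.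
  by congr (_ `^ _); ring.
have [lam [l0 ly hl]] := optimal_parameter E0 x0 y0.
have := @tail_bound _ _ _ P _ _ _ _ _ _ _ _ x _ H n0
  (@measurable_weight _ _ _ b n phi) (sum_sqr_weight_le1 b n phi) al01 l0 (ltW y0) ly.
move=> /le_trans; apply; rewrite lee_fin yE lerD2r ler_expR -xyE.
exact: hl.
Qed.

(** Write [n = t * u] with [t = n ^ (alpha / 2)] and [u >= 1]. The Bernstein exponent is at least
    [c1 * t] because [E + u * q <= u * (E + q)]. *)
Lemma tail_rescaling {R : realType} (alpha E F x : R) : 0 < alpha < 1 -> 0 <= E -> 0 < x ->
  exists c : R, 0 < c /\ exists C : R, forall n : nat, (1 <= n)%N ->
    expR (- ((Num.sqrt n%:R * x) ^+ 2 /
      (2 * (E + (Num.sqrt n%:R * x) `^ (2 - alpha) / 3)))) +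
    n%:R * F * expR (- (Num.sqrt n%:R * x) `^ alpha) <=
    C * expR (- (c * n%:R `^ (alpha / 2))).
Proof.
move=> /andP[al0 al1] E0 x0.
pose q := x `^ (2 - alpha) / 3.
have q0 : 0 < q by rewrite divr_gt0// powR_gt0.
pose c1 := x ^+ 2 / (2 * (E + q)).
(* Half of the exponent [x ^ alpha * t] is kept for decay; the other half absorbs the factor [n]. *)
pose c2 := x `^ alpha / 2.
have c10 : 0 < c1 by rewrite divr_gt0 ?exprn_gt0// mulr_gt0// ltr_wpDl.
have c20 : 0 < c2 by rewrite divr_gt0// powR_gt0.
have [C0 C00 nC] := expR_natM_le al0 c20.
exists (Num.min c1 c2); split; first by rewrite lt_min c10.
exists (1 + `|F| * C0) => n n1.
set t := n%:R `^ (alpha / 2).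
pose u : R := n%:R `^ (1 - alpha / 2).
have nge1 : (1 : R) <= n%:R by rewrite ler1n.
have ngt0 : (0 : R) < n%:R by rewrite ltr0n.
have t0 : 0 <= t by exact: powR_ge0.
have u1 : 1 <= u.
  rewrite -[leLHS](@powRr0 R n%:R); apply: ler_powR => //; lra.
have tu : n%:R = t * u.
  rewrite /t /u -powRD; last by apply/implyP => _; rewrite gt_eqF.
  by rewrite addrC subrK powRr1// ltW.
have sqn p : Num.sqrt (n%:R : R) `^ p = n%:R `^ (p / 2).
  by rewrite -(@powR12_sqrt R n%:R (ltW ngt0)) -powRrM mulrC.
have X2 : (Num.sqrt n%:R * x) ^+ 2 = t * u * x ^+ 2.
  by rewrite exprMn sqr_sqrtr ?ltW// -tu.
have Xa : (Num.sqrt n%:R * x) `^ alpha = 2 * c2 * t.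
  by rewrite powRM ?sqrtr_ge0 ?ltW// sqn /c2 -/t; field.
have Xb : (Num.sqrt n%:R * x) `^ (2 - alpha) / 3 = u * q.
  rewrite powRM ?sqrtr_ge0 ?ltW// sqn /q mulrA; congr (_ * _ / _).
  by rewrite /u; congr (_ `^ _); field.
rewrite X2 Xa Xb [leRHS]mulrDl mul1r; apply: lerD.
  rewrite ler_expR lerN2; apply: (@le_trans _ _ (c1 * t)).
    by rewrite ler_wpM2r// ge_min lexx.
  have Eq0 : 0 < E + q by rewrite ltr_wpDl.
  have u0 : 0 < u by rewrite (lt_le_trans ltr01).
  have Euq0 : 0 < E + u * q by rewrite ltr_wpDl// mulr_gt0.
  have -> : c1 * t = t * u * x ^+ 2 / (2 * (u * (E + q))).
    by rewrite /c1; field; rewrite !gt_eqF.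
  rewrite ler_wpM2l//; first by rewrite !mulr_ge0 ?sqr_ge0// ltW.
  rewrite lef_pV2 ?posrE ?mulr_gt0// ler_pM2l// mulrDr lerD2r.
  by rewrite ler_peMl.
apply: (@le_trans _ _ (`|F| * C0 * expR (- (c2 * t)))); last first.
  rewrite ler_wpM2l ?mulr_ge0// ler_expR lerN2 ler_wpM2r// ge_min lexx orbT//.
rewrite (_ : expR (- (2 * c2 * t)) = expR (- (c2 * t)) * expR (- (c2 * t))); last first.
  by rewrite -expRD; congr expR; ring.
rewrite mulrA ler_wpM2r ?expR_ge0// -mulrA mulrCA.
apply: (@le_trans _ _ (`|F| * (n%:R * expR (- (c2 * t))))).
  by rewrite ler_wpM2r ?ler_norm// mulr_ge0 ?expR_ge0// ltW.
by rewrite ler_wpM2l// expRN ler_pdivrMr ?expR_gt0// nC.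
Qed.

Theorem theorem3p2 (d : measure_display) (T : measurableType d) (R : realType)
    (P : probability T R) (theta alpha E F : R) :
  0 < alpha < 1 ->
  (* main inequality, for every n and every model on indices 1..n *)
  (forall (n : nat) (phi eps : nat -> T -> R),
     regression_hyp P n phi eps alpha E F ->
     forall (b : bool) (x : R), 0 < x ->
       (P [set w | (x <= (-1) ^+ b * (thetan n theta phi eps w - theta)
                                  * Num.sqrt (sumsq n phi w))%R]
        <= (expR (- (x ^+ 2 / (2 * (E + x `^ (2 - alpha) / 3))))
            + n%:R * F * expR (- x `^ alpha))%R%:E)%E) /\
  (* asymptotic consequence, for sequences satisfying the hypotheses for all n *)
  (forall phi eps : nat -> T -> R,
     (forall n : nat, (1 <= n)%N -> regression_hyp P n phi eps alpha E F) ->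
     forall (b : bool) (x : R), 0 < x ->
       exists c : R, 0 < c /\ exists (C : R) (N : nat), forall n : nat, (N <= n)%N ->
         (P [set w | (Num.sqrt n%:R * x <= (-1) ^+ b * (thetan n theta phi eps w - theta)
                                  * Num.sqrt (sumsq n phi w))%R]
          <= (C * expR (- (c * n%:R `^ (alpha / 2))))%R%:E)%E).
Proof.
move=> al01; split=> [n phi eps H b x x0|phi eps H b x x0].
  exact: self_normalized_tail.
have E0 : 0 <= E by exact: regression_bound_ge0 (H 1%N isT).
have [c [c0 [C hC]]] := tail_rescaling F al01 E0 x0.
(* Starting at [n = 1] keeps the threshold [sqrt n * x] positive. *)
exists c; split => //; exists C, 1%N => n n1.
apply: le_trans (self_normalized_tail _ _ al01 (H n n1) _) _.
  by rewrite mulr_gt0// sqrtr_gt0 ltr0n.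
by rewrite lee_fin; exact: hC.
Qed.
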